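(* $p = 13$ is the only prime number $p$ for which the greatest number of consecutive quadratic non-residues modulo $p$ exceeds $p^{1/2}$.
   Context: For a prime $p$, an integer $n$ is a quadratic non-residue modulo $p$ if $p \nmid n$ and there is no integer $x$ with $x^2 \equiv n \pmod p$. The greatest number of consecutive quadratic non-residues modulo $p$ is the largest number $\ell \ge 0$ for which there exist $\ell$ consecutive integers all of which are quadratic non-residues modulo $p$. *)

(* Defs.v *)
From mathcomp Require Import all_boot all_order all_algebra.

Set Implicit Arguments.
Unset Strict Implicit.
Unset Printing Implicit Defensive.

Import Order.TTheory GRing.Theory Num.Theory.
Local Open Scope ring_scope.

Definition quadratic_nonresidue (p : nat) (n : int) : Prop :=
  ~~ (p%:Z %| n)%Z /\ ~ (exists x : int, (x ^+ 2 = n %[mod p%:Z])%Z).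

Definition has_nonresidue_run (p l : nat) : Prop :=
  exists a : int,
    forall i : nat, (i < l)%N -> quadratic_nonresidue p (a + i%:Z).

Definition greatest_nonresidue_run (p l : nat) : Prop :=
  has_nonresidue_run p l /\
  (forall m : nat, has_nonresidue_run p m -> (m <= l)%N).

(* Main.v *)
Require Import Defs.
From Stdlib Require Import BinNat Nnat Classical_Prop.
From mathcomp Require Import all_boot all_order all_algebra all_solvable all_field.
From mathcomp Require Import zify ring.

Set Implicit Arguments.
Unset Strict Implicit.
Unset Printing Implicit Defensive.

Import Order.TTheory GRing.Theory Num.Theory.
Local Open Scope ring_scope.

(** Let m be the integer part of sqrt p and suppose that the m + 1 integers of
    I = [a, a + m] are all nonresidues; chi is the Legendre symbol. If p = 3
    mod 4 (Brauer), m + 1 or - (m + 1) is a nonresidue c, and c I meets I since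
    the numbers c i - j with 0 <= i, j <= m cover all classes mod p.

    If p = 1 mod 4, then I contains no square, which puts it between p/4 and
    3p/4, and I may be replaced by p - I. Say that d straddles if the interval
    [d a, d (a + m)] contains a multiple of p. Then u I meets v I mod p
    whenever u = v + d <= m + 1 with v prime to d, so that chi (v + d) = chi v.
    For d close to m, two consecutive d cannot both fail to straddle.
    - If chi 2 = 1 and chi 3 = -1, comparing v = 1, 2, 3 for d - 1, ..., d + 2
      with d = 2 mod 6 is contradictory.
    - If chi 2 = -1, comparing v = 1, 2, 4 shows that no odd d near m straddles,
      which forces p/2 to lie in I. Hence every odd n <= m is a residue, and
      so is some 3 (t - s) (t + s) = p + 2 z with z odd and |z| <= m, although
      2 z is a nonresidue.
    - If chi 2 = chi 3 = 1, then one of p - 2 I, p - 3 I and 3 I - p contains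
      plus or minus w^2 or 2 w^2 for some w.
    These estimates need m >= 64; smaller p are checked by computation. *)

(** * Squares in the prime field and the Legendre symbol *)

Lemma prime_field_generator p : prime p ->
  exists z : 'F_p, (p.-1).-primitive_root z.
Proof.
move=> pp; have p1 := prime_gt1 pp.
have un : uniq (enum [pred x : 'F_p | x != 0]) by apply: enum_uniq.
have : has (p.-1).-primitive_root (enum [pred x : 'F_p | x != 0]).
  apply: has_prim_root => //; first by lia.
    apply/allP => x; rewrite mem_enum inE => nx0; apply/unity_rootP.
    apply: (mulfI nx0); rewrite mulr1 -exprS prednK ?prime_gt0//.
    by rewrite -[X in x ^+ X](card_Fp pp) expf_card.
  rewrite -cardE.
  have := cardC1 (0 : 'F_p); rewrite card_Fp // => <-.
  by apply: subset_leq_card; apply/subsetP => x; rewrite !inE.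
by case/hasP => z _ hz; exists z.
Qed.

Definition is_square (F : finFieldType) (x : F) := [exists y : F, y ^+ 2 == x].

Lemma is_squareP (F : finFieldType) (x : F) :
  reflect (exists y, y ^+ 2 = x) (is_square x).
Proof. by apply: (iffP existsP) => -[y] /eqP; exists y => //; apply/eqP. Qed.

Definition legendre (p : nat) (n : int) : int :=
  if n%:~R == 0 :> 'F_p then 0
  else if is_square (n%:~R : 'F_p) then 1 else -1.

Section Legendre.

Variable p : nat.
Hypothesis p_prime : prime p.

Lemma Fp_nonzero_pow (z : 'F_p) : (p.-1).-primitive_root z ->
  forall x : 'F_p, x != 0 -> exists k, x = z ^+ k.
Proof.
move=> hz x nx0; have p1 := prime_gt1 p_prime.
have [|i ->] := prim_rootP hz (x := x); last by exists i.
apply: (mulfI nx0); rewrite mulr1 -exprS prednK ?prime_gt0//.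
by rewrite -[X in x ^+ X](card_Fp p_prime) expf_card.
Qed.

(** Only the product of two nonsquares needs a generator: both exponents are odd, so their sum is
    even. *)
Lemma is_square_mul (x y : 'F_p) : x != 0 -> y != 0 ->
  is_square (x * y) = (is_square x == is_square y).
Proof.
move=> nx0 ny0; apply/idP/eqP.
  move=> /is_squareP[w hw]; apply/idP/idP => /is_squareP[u hu]; apply/is_squareP.
    by exists (w / u); rewrite expr_div_n hw hu mulrAC divff // mul1r.
  by exists (w / u); rewrite expr_div_n hw hu mulfK.
case: (boolP (is_square x)) => [/is_squareP[u <-] /esym/is_squareP[v <-]|].
  by apply/is_squareP; exists (u * v); rewrite exprMn.
have [z hz] := prime_field_generator p_prime.
have [i ->] := Fp_nonzero_pow hz nx0; have [j ->] := Fp_nonzero_pow hz ny0.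
have even_square k : ~~ odd k -> is_square (z ^+ k).
  move=> ek; apply/is_squareP; exists (z ^+ k./2).
  by rewrite -exprM muln2 -[in RHS](odd_double_half k) (negPf ek).
have odd_of k : ~~ is_square (z ^+ k) -> odd k.
  by apply: contraNT; apply: even_square.
move=> /odd_of oi /esym/negbT/odd_of oj.
by rewrite -exprD; apply: even_square; rewrite oddD oi oj.
Qed.

Lemma legendreM (x y : int) : legendre p (x * y) = legendre p x * legendre p y.
Proof.
rewrite /legendre intrM mulf_eq0.
case: eqP => //= /eqP nx0; first by rewrite mul0r.
case: eqP => //= /eqP ny0; first by rewrite mulr0.
by rewrite is_square_mul //; do 2!case: is_square.
Qed.

Lemma legendre_periodic (x k : int) : legendre p (x + k * p%:Z) = legendre p x.
Proof.
rewrite /legendre intrD intrM -pmulrn.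
by rewrite (pcharf0 (pchar_Fp p_prime)) mulr0 addr0.
Qed.

Lemma legendre_neq0 x : ~~ (p %| x)%Z ->
  legendre p x = 1 \/ legendre p x = -1.
Proof.
rewrite (dvdz_pcharf (pchar_Fp p_prime)) /legendre => /negPf->.
by case: is_square; [left|right].
Qed.

Lemma legendreN1 : odd p ->
  legendre p (-1) = if (p %% 4)%N == 1%N then 1 else -1.
Proof.
move=> op; have p1 := prime_gt1 p_prime.
have n1 : (-1 : 'F_p) != 0 by rewrite oppr_eq0 oner_eq0.
rewrite /legendre rmorphN1 (negPf n1).
have [z hz] := prime_field_generator p_prime.
have hz1 : z ^+ (p.-1)./2 = -1.
  have : (z ^+ (p.-1)./2) ^+ 2 = 1.
    rewrite -exprM muln2 -[RHS](prim_expr_order hz); congr (_ ^+ _); lia.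
  move/eqP; rewrite sqrf_eq1 => /orP[|/eqP//].
  rewrite -(prim_order_dvd hz) => /dvdn_leq; lia.
case: eqP => p4.
  rewrite ifT //; apply/is_squareP; exists (z ^+ (p %/ 4)).
  by rewrite -exprM -hz1; congr (_ ^+ _); lia.
(* Here [p.-1] is twice an odd number, so a square root [y] of -1 would give
   [1 = y ^+ p.-1 = -1]. *)
rewrite ifF //; apply/negbTE/negP => /is_squareP[y hy].
have ny0 : y != 0 by apply: contraNneq n1 => y0; rewrite -hy y0 expr0n.
have : y ^+ p.-1 = 1.
  apply: (mulfI ny0); rewrite mulr1 -exprS prednK ?prime_gt0//.
  by rewrite -[X in y ^+ X](card_Fp p_prime) expf_card.
have -> : p.-1 = (2 * (2 * (p %/ 4)).+1)%N by lia.
rewrite exprM hy exprS exprM sqrrN !expr1n mulr1 => /eqP.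
rewrite -subr_eq0 -opprD oppr_eq0 -[1 + 1]/(2%:R).
rewrite -(dvdn_pcharf (pchar_Fp p_prime)) => /dvdn_leq; lia.
Qed.

Lemma quadratic_nonresidueP n : quadratic_nonresidue p n <-> legendre p n = -1.
Proof.
have dE x : (p %| x)%Z = (x%:~R == 0 :> 'F_p) := dvdz_pcharf (pchar_Fp p_prime) x.
rewrite /quadratic_nonresidue /legendre dE; split.
  move=> [/negPf-> nsq]; rewrite ifF //; apply/negbTE/negP => /is_squareP[y hy].
  apply: nsq; exists (y : nat)%:Z; apply/eqP.
  rewrite eqz_mod_dvd dE rmorphB rmorphXn /= -hy subr_eq0; apply/eqP.
  by rewrite -pmulrn natr_Zp.
case: eqP => // _; case: (boolP (is_square _)) => // nsq _; split=> // -[x /eqP].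
rewrite eqz_mod_dvd dE rmorphB rmorphXn /= subr_eq0 => /eqP hx.
by move/negP: nsq; apply; apply/is_squareP; exists x%:~R.
Qed.

End Legendre.

(** * Integer square roots and squares in progressions *)

Lemma int_sqrt (n : int) : 0 <= n ->
  exists2 w : int, 0 <= w & w * w <= n < (w + 1) * (w + 1).
Proof.
case: n => // n _; elim: n => [|n [w w0 hw]]; first by exists 0.
have [h|h] := lerP ((w + 1) * (w + 1)) (Posz n.+1).
  by exists (w + 1); [lia | nia].
by exists w; [lia | nia].
Qed.

Lemma int_sqrt_scaled (c n : int) : 0 < c -> 0 <= n ->
  exists2 w : int, 0 <= w & c * (w * w) <= n < c * ((w + 1) * (w + 1)).
Proof.
move=> c0 n0; have [|w w0 hw] := @int_sqrt (n %/ c)%Z; first by rewrite divz_ge0.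
have := divz_eq n c; have := ltz_pmod n c0; have := modz_ge0 n (lt0r_neq0 c0).
by exists w => //; nia.
Qed.

(* Consecutive values c w^2 with w prime to s differ by at most c (4 w + 4). *)
Lemma square_in_progression (s c m N : int) : s = 2 \/ s = 3 -> 0 < c ->
  c <= N -> (exists e, N - c = s * e) ->
  4 * c <= s * m -> 16 * c * N <= (s * m - 4 * c) * (s * m - 4 * c) ->
  exists w i, [/\ 0 < w, w * w <= N, 0 <= i <= m & N = c * (w * w) + s * i].
Proof.
move=> hs c0 cN [e he] hm hN.
have [||w0 w00 hw0] := @int_sqrt_scaled c N; [lia|lia|].
have w1 : 1 <= w0 by nia.
(* [w] is [w0], or [w0 - 1] if [s] divides [w0]; being prime to [s], it has square 1 modulo [s]. *)
have [w [f [w_pos w_le w_ge hf]]] : exists w f : int,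
    [/\ 0 < w, w <= w0, w0 <= w + 1 & w * w - 1 = s * f].
  case: hs => ->.
    have [[q hq]|[q hq]] : (exists q, w0 = 2 * q + 1) \/ (exists q, w0 = 2 * q).
    - have [h|h] : w0 = 2 * (w0 %/ 2)%Z + 1 \/ w0 = 2 * (w0 %/ 2)%Z by lia.
        by left; exists (w0 %/ 2)%Z.
      by right; exists (w0 %/ 2)%Z.
    - by exists (2 * q + 1), (2 * q * q + 2 * q); split; nia.
    - by exists (2 * q - 1), (2 * q * q - 2 * q); split; nia.
  have [q hq] : exists q, [\/ w0 = 3 * q, w0 = 3 * q + 1 | w0 = 3 * q + 2].
    exists (w0 %/ 3)%Z.
    have [h|[h|h]] : w0 = 3 * (w0 %/ 3)%Z \/ w0 = 3 * (w0 %/ 3)%Z + 1 \/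
        w0 = 3 * (w0 %/ 3)%Z + 2 by lia.
    - by constructor 1.
    - by constructor 2.
    - by constructor 3.
  case: hq => hq.
  - by exists (3 * q - 1), (3 * q * q - 2 * q); split; nia.
  - by exists (3 * q + 1), (3 * q * q + 2 * q); split; nia.
  - by exists (3 * q + 2), (3 * q * q + 4 * q + 1); split; nia.
have lt_w : N < c * ((w + 2) * (w + 2)) by nia.
have le_w : c * (w * w) <= N by nia.
have cw : 4 * c * w <= s * m - 4 * c.
  rewrite leNgt; apply/negP => hlt.
  have : (4 * c * w) * (4 * c * w) <= (s * m - 4 * c) * (s * m - 4 * c) by nia.
  nia.
exists w, (e - c * f); split => //; [nia | | nia].
by case: hs => hs; nia.
Qed.

(** * Runs for an abstract real character; Brauer's odd case *)

Section NonresidueRun.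

Variables (p m : int) (chi : int -> int).
Hypothesis m_gt0 : 0 < m.
Hypothesis p_gt2 : 2 < p.
Hypothesis m_sqr : m * m < p < (m + 1) * (m + 1).
Hypothesis chiM : forall x y, chi (x * y) = chi x * chi y.
Hypothesis chi_periodic : forall x k, chi (x + k * p) = chi x.
Hypothesis chi_sign : forall x, 0 < x < p -> chi x = 1 \/ chi x = -1.

Definition run (a : int) := forall i, 0 <= i <= m -> chi (a + i) = -1.

Lemma chi1 : chi 1 = 1.
Proof. by have := chiM 1 1; rewrite mulr1; case: (@chi_sign 1 (ltac:(lia))) => ->. Qed.

Lemma chi_sqr w : 0 < w < p -> chi (w * w) = 1.
Proof. by move=> /chi_sign; rewrite chiM; case=> ->. Qed.

Lemma chi_mod x y k : x = y + k * p -> chi x = chi y.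
Proof. by move=> ->. Qed.

(** [chi 0] is its own square, hence not -1, so a run avoids the multiples of [p]. *)
Lemma run_in_period a : run a -> exists b, [/\ 0 < b, b + m < p & run b].
Proof.
move=> ra; have p0 : 0 < p by lia.
pose b := (a %% p)%Z.
have hb : b = a + - (a %/ p)%Z * p by rewrite /b; have := divz_eq a p; lia.
have b0 := modz_ge0 a (lt0r_neq0 p0); have b1 := ltz_pmod a p0.
rewrite -/b in b0 b1.
have rb : run b by move=> i hi; rewrite hb addrAC chi_periodic ra.
have chi0 : chi 0 != -1.
  by apply/eqP => h; have := chiM 0 0; rewrite mul0r h; lia.
have mult0 i : 0 <= i <= m -> forall k, b + i <> k * p.
  move=> hi k hk; have := rb i hi; rewrite hk -[k * p]add0r chi_periodic => h.
  by rewrite h eqxx in chi0.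
exists b; split=> //.
  by rewrite lt_neqAle b0 andbT; apply/eqP => h; apply: (mult0 0 _ 0); lia.
rewrite ltNge; apply/negP => h.
by apply: (mult0 (p - b) _ 1); lia.
Qed.

Lemma run_collision a u v i j k : run a -> 0 <= i <= m -> 0 <= j <= m ->
  u * (a + i) = v * (a + j) + k * p -> chi u = chi v.
Proof. by move=> ra hi hj /chi_mod; rewrite !chiM !ra //; lia. Qed.

(* Brauer: one of m+1 and -(m+1) is a nonresidue, and its multiple of the run
   meets the run since (m+1) i - j and (m+1) i + j cover all classes mod p. *)
Lemma no_run_odd_character a : (forall x, chi (- x) = - chi x) -> ~ run a.
Proof.
move=> chiN ra; have ltmp : m + 1 < p by nia.
pose L : int := m + 1.
have L0 : 0 < L by lia.
have p0 : 0 < p by lia.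
have [hL|hL] := @chi_sign L (ltac:(lia)).
  (* As [X < p < L^2], dividing [X] by [L] gives digits [i], [j] in [[0, m]] with
     [- L (a + i) = a + j] modulo [p]. *)
  pose X := (- (a * (L + 1)) %% p)%Z.
  have hX := divz_eq (- (a * (L + 1))) p.
  have hX0 := modz_ge0 (- (a * (L + 1))) (lt0r_neq0 p0).
  have hX1 := ltz_pmod (- (a * (L + 1))) p0.
  have hi := divz_eq X L.
  have hi0 := modz_ge0 X (lt0r_neq0 L0).
  have hi1 := ltz_pmod X L0.
  rewrite -/X in hX hX0 hX1.
  have : chi (- L) = chi 1.
    apply: (@run_collision a _ _ (X %/ L)%Z (X %% L)%Z
                (- (a * (L + 1)) %/ p)%Z) => //; try lia.
    by apply/andP; split; nia.
  by rewrite chiN chi1; lia.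
pose X := ((a * (1 - L) + m) %% p)%Z.
have hX := divz_eq (a * (1 - L) + m) p.
have hX0 := modz_ge0 (a * (1 - L) + m) (lt0r_neq0 p0).
have hX1 := ltz_pmod (a * (1 - L) + m) p0.
have hi := divz_eq X L.
have hi0 := modz_ge0 X (lt0r_neq0 L0).
have hi1 := ltz_pmod X L0.
rewrite -/X in hX hX0 hX1.
have : chi L = chi 1.
  apply: (@run_collision a _ _ (X %/ L)%Z (m - (X %% L)%Z)
              (- ((a * (1 - L) + m) %/ p)%Z)) => //; try lia.
  by apply/andP; split; nia.
by rewrite chi1; lia.
Qed.

(** * Even characters: position of the run and straddling *)

Hypothesis chiN1 : chi (-1) = 1.

Lemma chiN x : chi (- x) = chi x.
Proof. by rewrite -mulN1r chiM chiN1 mul1r. Qed.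

Lemma run_reflect a : run a -> run (p - a - m).
Proof.
move=> ra i hi; rewrite -chiN -(ra (m - i)); last by lia.
by apply: (@chi_mod _ _ (-1)); lia.
Qed.

(** If [w^2] is the last square before the run, then [(w + 1)^2 > a + m], so [2 w + 1 >= m + 2] and
    [4 a > 4 w^2 >= (m + 1)^2]. *)
Lemma run_lower_bound a : 0 < a -> a + m < p -> run a ->
  (m + 1) * (m + 1) < 4 * a.
Proof.
move=> a0 ap ra; have [w w0 hw] := @int_sqrt a (ltac:(lia)).
have sq_out z : 0 < z -> z * z < a \/ a + m < z * z.
  move=> z0; have [h1|h1] := ltrP (z * z) a; first by left.
  have [h2|h2] := lerP (z * z) (a + m); last by right.
  have zp : 0 < z < p by apply/andP; split; nia.
  by have := chi_sqr zp; have := ra (z * z - a) (ltac:(lia)); rewrite addrC subrK => ->.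
have := @sq_out (w + 1); have := @sq_out w; nia.
Qed.

Definition straddles a d := exists k, d * a <= k * p <= d * (a + m).

Definition misses a d k := k * p < d * a /\ d * (a + m) < (k + 1) * p.

Lemma straddlesVmisses a d : straddles a d \/ exists k, misses a d k.
Proof.
have p0 : 0 < p by lia.
have h1 := divz_eq (d * a) p.
have h2 := modz_ge0 (d * a) (lt0r_neq0 p0).
have h3 := ltz_pmod (d * a) p0.
set k := (d * a %/ p)%Z in h1.
have [e|ne] := eqVneq (k * p) (d * a).
  have [dm|dm] := lerP 0 (d * m).
    by left; exists k; lia.
  by right; exists (k - 1); split; nia.
have [h|h] := lerP ((k + 1) * p) (d * (a + m)).
  by left; exists (k + 1); nia.
by right; exists k; split; [lia | nia].
Qed.

(* If some multiple kp of p lies between da and d(a+m), then u(a+i) - v(a+j)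
   with u = v + d takes the value kp for suitable i, j. *)
Lemma straddle_shift a d v x y : run a -> 0 < d -> 0 < v -> v + d <= m + 1 ->
  v * x + d * y = 1 -> straddles a d -> chi (v + d) = chi v.
Proof.
move=> ra d0 v0 vd bez [k hk].
pose u := v + d; pose C := k * p - d * a.
have u0 : 0 < u by lia.
(* Since [v (x - y) + u y = 1], the pair [i = C y], [j = - C (x - y)] solves [u i - v j = C];
   reducing [j] modulo [u] brings both into [[0, m]]. *)
pose T := - (C * (x - y)).
have hj := divz_eq T u.
have hj0 := modz_ge0 T (lt0r_neq0 u0).
have hj1 := ltz_pmod T u0.
set j := (T %% u)%Z in hj hj0 hj1; set q := (T %/ u)%Z in hj.
pose i := C * y - v * q.
have hi : u * i = C + v * j.
  have -> : j = T - q * u by lia.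
  have {1}-> : C = C * (v * x + d * y) by rewrite bez mulr1.
  by rewrite /i /T /u; ring.
apply: (@run_collision a _ _ i j k) => //; rewrite -/u.
- by apply/andP; split; nia.
- by lia.
- by rewrite mulrDr hi /C /u; ring.
Qed.

(** If [l <= k], then [(d + 1) (a + m) - d a < p], against the lower bound on [a]; if [l > k], then
    [d (a + m) < (k + 1) p < (d + 1) a], so [a > d m]. *)
Lemma misses_consecutive a d k l : p - (d + 1) * m <= a <= d * m ->
  misses a d k -> misses a (d + 1) l -> False.
Proof.
move=> ha [h1 h2] [h3 h4].
have [h|h] := lerP (l - k) 0; nia.
Qed.


(** * Primes [p = 1] modulo 4 with [m] at least 64 *)

Hypothesis m_ge64 : 64 <= m.
Hypothesis p_mod4 : exists q, p = 4 * q + 1.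

Section BoundedRun.

Variable a : int.
Hypothesis run_a : run a.
Hypothesis a_lower : p < 4 * a.
Hypothesis a_upper : 4 * (a + m) < 3 * p.

Lemma misses_not_consecutive d k l : m - 15 <= d <= m ->
  misses a d k -> misses a (d + 1) l -> False.
Proof. by move=> hd; apply: misses_consecutive; apply/andP; split; nia. Qed.

(** If [d] straddles, [chi (d + 3) = chi 3], while [d + 1] or [d + 2] straddles and makes it [chi 2]
    or [chi 1]. If [d] misses, both [d - 1] and [d + 1] straddle, and [chi (d + 2)] equals both
    [chi 3] and [chi 1]. *)
Lemma run_chi3 : chi 2 = 1 -> chi 3 <> -1.
Proof.
move=> c2 c3.
have [e [he1 he2]] : exists e : int, m - 8 <= 6 * e + 2 /\ 6 * e + 2 <= m - 3.
  by exists ((m - 5) %/ 6)%Z; lia.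
pose d := 6 * e + 2.
have [gd|[k bd]] := straddlesVmisses a d.
  have c5 : chi (3 + d) = -1.
    by rewrite -c3; apply: (@straddle_shift a d 3 (2 * e + 1) (-1)); rewrite /d //; lia.
  have [gd1|[k1 bd1]] := straddlesVmisses a (d + 1).
    have : chi (2 + (d + 1)) = chi 2.
      by apply: (@straddle_shift a _ 2 (- (3 * e + 1)) 1); rewrite // /d; lia.
    by rewrite (_ : 2 + (d + 1) = 3 + d) ?c5 ?c2 //; lia.
  have [gd2|[k2 bd2]] := straddlesVmisses a (d + 1 + 1).
    have : chi (1 + (d + 1 + 1)) = chi 1.
      by apply: (@straddle_shift a _ 1 1 0); rewrite // /d; lia.
    by rewrite (_ : 1 + (d + 1 + 1) = 3 + d) ?c5 ?chi1 //; lia.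
  by apply: (misses_not_consecutive _ bd1 bd2); rewrite /d; lia.
have [gd1|[k1 bd1]] := straddlesVmisses a (d + 1); last first.
  by apply: (misses_not_consecutive _ bd bd1); rewrite /d; lia.
have [gd0|[k0 bd0]] := straddlesVmisses a (d - 1); last first.
  by apply: (misses_not_consecutive _ bd0 (l := k)); rewrite ?subrK // /d; lia.
have : chi (3 + (d - 1)) = chi 3.
  by apply: (@straddle_shift a _ 3 (- (2 * e)) 1); rewrite // /d; lia.
have : chi (1 + (d + 1)) = chi 1.
  by apply: (@straddle_shift a _ 1 1 0); rewrite // /d; lia.
by rewrite (_ : 1 + (d + 1) = 3 + (d - 1)) ?c3 ?chi1 => [->|]; lia.
Qed.

(** If [d] straddled, [chi (d + 2) = -1] and [chi (d + 4) = 1]; straddling by [d + 1] contradicts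
    the first, by [d + 2] the second. *)
Lemma odd_misses e : chi 2 = -1 -> m - 16 <= 2 * e + 1 <= m - 3 ->
  exists k, misses a (2 * e + 1) k.
Proof.
move=> c2 he; set d := 2 * e + 1.
have [gd|//] := straddlesVmisses a d; exfalso.
have c2d : chi (2 + d) = -1.
  by rewrite -c2; apply: (@straddle_shift a d 2 (- e) 1); rewrite // /d; lia.
have c4d : chi (4 + d) = 1.
  have -> : chi (4 + d) = chi 4.
    have [[f hf]|[f hf]] : (exists f, e = 2 * f) \/ (exists f, e = 2 * f + 1).
      have [h|h] : e = 2 * (e %/ 2)%Z \/ e = 2 * (e %/ 2)%Z + 1 by lia.
        by left; exists (e %/ 2)%Z.
      by right; exists (e %/ 2)%Z.
    - by apply: (@straddle_shift a d 4 (- f) 1); rewrite // /d; lia.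
    - by apply: (@straddle_shift a d 4 (f + 1) (-1)); rewrite // /d; lia.
  by rewrite (_ : 4 = 2 * 2) // chiM c2.
have [gd1|[k1 bd1]] := straddlesVmisses a (d + 1).
  have : chi (1 + (d + 1)) = chi 1.
    by apply: (@straddle_shift a _ 1 1 0); rewrite // /d; lia.
  by rewrite (_ : 1 + (d + 1) = 2 + d) ?chi1 ?c2d //; lia.
have [gd2|[k2 bd2]] := straddlesVmisses a (d + 1 + 1).
  have : chi (2 + (d + 1 + 1)) = chi 2.
    by apply: (@straddle_shift a _ 2 (- (e + 1)) 1); rewrite // /d; lia.
  by rewrite (_ : 2 + (d + 1 + 1) = 4 + d) ?c2 ?c4d //; lia.
by apply: (misses_not_consecutive _ bd1 bd2); rewrite /d; lia.
Qed.

Lemma misses_pred2 d k l : p < 2 * a -> m - 14 <= d <= m ->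
  misses a d k -> misses a (d - 2) l -> l = k - 1.
Proof.
move=> pa hd [h1 h2] [h3 h4].
have [h5|h5] := lerP (k - l) 0; first by nia.
by have [h6|h6] := lerP 2 (k - l); [nia | lia].
Qed.

(* Descending six steps d -> d - 2, an interval with 2 a > p is trapped between
   odd multiples of p/(2d) and p/(2(d-12)) that are too close for its length. *)
Lemma run_left_end : chi 2 = -1 -> 2 * a < p.
Proof.
move=> c2; rewrite ltNge; apply/negP => pa'.
have [e [he1 he2]] : exists e : int, m - 4 <= 2 * e + 1 /\ 2 * e + 1 <= m - 3.
  by exists ((m - 4) %/ 2)%Z; lia.
have pa : p < 2 * a by have [q hq] := p_mod4; lia.
have B j : 0 <= j <= 6 -> exists k, misses a (2 * (e - j) + 1) k.
  by move=> hj; apply: odd_misses => //; lia.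
have [k0 b0] := @B 0 isT; have [k1 b1] := @B 1 isT; have [k2 b2] := @B 2 isT.
have [k3 b3] := @B 3 isT; have [k4 b4] := @B 4 isT; have [k5 b5] := @B 5 isT.
have [k6 b6] := @B 6 isT.
have step j k l : 0 <= j <= 5 -> misses a (2 * (e - j) + 1) k ->
    misses a (2 * (e - (j + 1)) + 1) l -> l = k - 1.
  move=> hj bk bl; apply: (misses_pred2 pa _ bk); first by lia.
  by rewrite (_ : _ - 2 = 2 * (e - (j + 1)) + 1) //; lia.
have := step _ _ _ _ b0 b1; have := step _ _ _ _ b1 b2; have := step _ _ _ _ b2 b3.
have := step _ _ _ _ b3 b4; have := step _ _ _ _ b4 b5; have := step _ _ _ _ b5 b6.
move=> /(_ isT) e6 /(_ isT) e5 /(_ isT) e4 /(_ isT) e3 /(_ isT) e2 /(_ isT) e1.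
have k6E : k6 = k0 - 6 by lia.
case: b0 b6 => _ h1 [h2 _]; rewrite k6E in h2.
pose d := 2 * e + 1.
have {}h1 : d * (a + m) < (k0 + 1) * p by rewrite /d -[e]subr0.
have {}h2 : (k0 - 6) * p < (d - 12) * a.
  by rewrite (_ : d - 12 = 2 * (e - 6) + 1) // /d; lia.
(* [k0 <= e] would give [d (2 a + 2 m) < (d + 1) p], impossible as [2 a > p] and [2 d m > p]. *)
have hk : d + 1 <= 2 * k0.
  suff : e < k0 by rewrite /d; lia.
  rewrite ltNge; apply/negP => hk.
  have : d * (2 * a + 2 * m) < (d + 1) * p by rewrite /d; nia.
  by rewrite /d; nia.
(* Eliminating [a] from [h1] and [h2] leaves [d (d - 12) m < p (7 d - 12 k0 - 12)]; then [hk]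
   applies. *)
have h3 : d * (d - 12) * m < p * (d - 18).
  have : d * ((k0 - 6) * p) + d * (d - 12) * m < (k0 + 1) * p * (d - 12).
    apply: (@le_lt_trans _ _ (d * ((d - 12) * a) + d * (d - 12) * m)).
      by rewrite lerD2r ler_pM2l; [apply: ltW | rewrite /d; lia].
    rewrite (_ : _ + _ = d * (a + m) * (d - 12)); last by ring.
    by rewrite ltr_pM2r // /d; lia.
  have : 0 <= p * (12 * k0 - 6 * d - 6) by apply: mulr_ge0; lia.
  by lia.
have [ed|ed] : d = m - 3 \/ d = m - 4 by rewrite /d; lia.
- by rewrite ed in h3; nia.
- by rewrite ed in h3; nia.
Qed.

End BoundedRun.

(** For odd [t] in [[1, m]] the run contains [(p + t) / 2], so [chi t = chi 2 * -1]. *)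
Lemma odd_chi_eq1 a n : run a -> p <= 2 * a + m -> 2 * a < p -> chi 2 = -1 ->
  1 <= 2 * n + 1 <= m -> chi (2 * n + 1) = 1.
Proof.
move=> ra pa ap c2 hn; have [q hq] := p_mod4.
have -> : chi (2 * n + 1) = chi (2 * (a + (2 * q + n + 1 - a))).
  by apply: (@chi_mod _ _ (-1)); lia.
by rewrite chiM c2 ra //; lia.
Qed.

(** Greedy choice: [2 r + 1] is just above [sqrt (p / 3)], and [12 s^2] approximates the excess [D].
    As [6 s + 3 <= m], the values at [s] and [s + 1] differ by at most [4 m], so one of them is
    within [2 m] of [D]. *)
Lemma three_difference_of_squares : exists r s : int,
  let n := 3 * ((2 * r + 1) * (2 * r + 1) - 2 * s * (2 * s)) in
  [/\ 0 <= s, s <= r, 2 * r + 1 + 2 * s <= m & - (2 * m) <= n - p <= 2 * m].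
Proof.
have [w w0 hw] : exists2 w, 0 <= w & 3 * (w * w) <= p < 3 * ((w + 1) * (w + 1)).
  by apply: int_sqrt_scaled; lia.
have [r hr] : exists r, w <= 2 * r <= w + 1.
  by exists ((w + 1) %/ 2)%Z; lia.
pose D := 3 * ((2 * r + 1) * (2 * r + 1)) - p.
have D0 : 0 <= D by rewrite /D; nia.
have Dw : D <= 12 * w + 12 by rewrite /D; nia.
have [s s0 hs] : exists2 s, 0 <= s & 12 * (s * s) <= D < 12 * ((s + 1) * (s + 1)).
  exact: int_sqrt_scaled.
have w_le : 5 * w <= 3 * (m + 1) by nia.
have s_le : 6 * s + 3 <= m.
  rewrite leNgt; apply/negP => hlt.
  have : s * s <= w + 1 by lia.
  by nia.
have [hc|hc] := lerP (D - 12 * (s * s)) (2 * m).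
  by exists r, s; rewrite /=; split => //; rewrite /D in hc hs; nia.
exists r, (s + 1); rewrite /=; split; [lia|nia|lia|].
by rewrite /D in hc hs *; apply/andP; split; lia.
Qed.

Lemma no_run_chi2N a : p < 4 * a -> 4 * (a + m) < 3 * p -> p <= 2 * a + m ->
  chi 2 = -1 -> ~ run a.
Proof.
move=> a1 a2 pa c2 ra; have ap := run_left_end ra a1 a2 c2.
have odd1 n : 1 <= 2 * n + 1 <= m -> chi (2 * n + 1) = 1.
  exact: (odd_chi_eq1 ra pa ap c2).
have [r [s /= [s0 sr rs hn]]] := three_difference_of_squares.
set n := 3 * _ in hn.
have [q hq] := p_mod4.
have chi_n : chi n = 1.
  rewrite /n (_ : _ - _ = (2 * (r + s) + 1) * (2 * (r - s) + 1)); last by ring.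
  by rewrite !chiM (_ : 3 = 2 * 1 + 1) // !odd1 //; lia.
(* [n = 3] and [p = 1] modulo 4, so [n - p] is twice an odd number, namely [2 * y + 1]. *)
pose y := 3 * r * r + 3 * r - 3 * s * s - q.
have hy : n = 2 * (2 * y + 1) + 1 * p by rewrite /n /y hq; ring.
have : chi (2 * y + 1) = 1.
  have [y0|y0] := lerP 0 y; first by apply: odd1; lia.
  rewrite -chiN (_ : - (2 * y + 1) = 2 * (- y - 1) + 1); last by lia.
  by apply: odd1; lia.
by move: chi_n; rewrite (chi_mod hy) chiM c2 => h1 h2; rewrite h2 in h1.
Qed.

Hypothesis p_mod3 : (p %% 3)%Z != 0.

(** For [a] near [p/2] the multiplier 2 is used, otherwise 3, with the sign set by the side of
    [p/3]. Squares prime to 3 are 1 modulo 3, so [c] is the residue of [N] modulo 3, nonzero since 3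
    does not divide [p]. *)
Lemma no_run_chi2R_chi3R a : p < 4 * a -> 2 * a + m <= p ->
  chi 2 = 1 -> chi 3 = 1 -> ~ run a.
Proof.
move=> a1 a2 c2 c3 ra; have [q hq] := p_mod4.
have chi_c2 c w : c = 1 \/ c = 2 -> 0 < w -> w * w < p -> chi (c * (w * w)) = 1.
  move=> hc w0 wp; rewrite chiM chi_sqr; last by apply/andP; split; nia.
  by case: hc => ->; rewrite ?chi1 ?c2.
have [h16|h16] := lerP (16 * (p - 2 * a)) ((2 * m - 4) * (2 * m - 4)).
  have [||||||w [i [w0 hw hi hN]]] := @square_in_progression 2 1 m (p - 2 * a).
  - by left.
  - by [].
  - by lia.
  - by exists (2 * q - a); lia.
  - by lia.
  - by lia.
  have : chi (2 * (a + i)) = chi (- (1 * (w * w))).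
    by apply: (@chi_mod _ _ 1); lia.
  by rewrite chiN chiM c2 ra // chi_c2 //; [left|lia].
have [t ht] : exists t, p = 3 * t + 1 \/ p = 3 * t + 2.
  by exists (p %/ 3)%Z; have := p_mod3; lia.
have mp : 64 * m < p by nia.
have [hN|hN] := lerP 1 (3 * (a + m) - p).
  have [c [e [hc he]]] : exists c e : int, (c = 1 \/ c = 2) /\
      3 * (a + m) - p - c = 3 * e.
    case: ht => ht; [exists 2, (a + m - t - 1) | exists 1, (a + m - t - 1)];
      by split; [auto | lia].
  have [||||||w [i [w0 hw hi hNE]]] :=
      @square_in_progression 3 c m (3 * (a + m) - p).
  - by right.
  - by lia.
  - by lia.
  - by exists e.
  - by lia.
  - by case: hc => ->; nia.
  have : chi (3 * (a + (m - i))) = chi (c * (w * w)).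
    by apply: (@chi_mod _ _ 1); lia.
  by rewrite (chiM 3) c3 ra ?chi_c2 //; lia.
have [c [e [hc he]]] : exists c e : int, (c = 1 \/ c = 2) /\
    p - 3 * a - c = 3 * e.
  case: ht => ht; [exists 1, (t - a) | exists 2, (t - a)];
    by split; [auto | lia].
have [||||||w [i [w0 hw hi hNE]]] := @square_in_progression 3 c m (p - 3 * a).
- by right.
- by lia.
- by lia.
- by exists e.
- by lia.
- by case: hc => ->; nia.
have : chi (3 * (a + i)) = chi (- (c * (w * w))).
  by apply: (@chi_mod _ _ 1); lia.
by rewrite chiN (chiM 3) c3 ra ?chi_c2 //; lia.
Qed.

Lemma no_run_in_period a : 0 < a -> a + m < p -> ~ run a.
Proof.
move=> a0 ap ra; have ra' := run_reflect ra.
have h1 := run_lower_bound a0 ap ra.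
have h2 : (m + 1) * (m + 1) < 4 * (p - a - m).
  by apply: run_lower_bound => //; lia.
have [c2|c2] := @chi_sign 2 (ltac:(lia)); last first.
  have [pa|pa] := lerP p (2 * a + m).
    by apply: (@no_run_chi2N a) => //; lia.
  by apply: (@no_run_chi2N (p - a - m)) => //; lia.
have [c3|c3] := @chi_sign 3 (ltac:(lia)); last first.
  by apply: (@run_chi3 a) => //; lia.
have [pa|pa] := lerP (2 * a + m) p.
  by apply: (@no_run_chi2R_chi3R a) => //; lia.
by apply: (@no_run_chi2R_chi3R (p - a - m)) => //; lia.
Qed.

Lemma no_run_even_character a : ~ run a.
Proof. by move=> /run_in_period[b [b0 b1 rb]]; apply: (no_run_in_period b0 b1 rb). Qed.

End NonresidueRun.

(** * Primes below [64^2] by computation *)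

(* The search runs over the integers t = c + k p: the largest square not
   exceeding t + l is a square of the window of c as soon as it exceeds t. *)
Fixpoint next_square (fuel : nat) (p l c t : N) : option N :=
  if fuel is fuel'.+1 then
    let y := N.sqrt (N.add t l) in
    if N.ltb t (N.mul y y) then Some (N.add c (N.sub (N.mul y y) t))
    else next_square fuel' p l c (N.add t p)
  else None.

(** Jumps of length at most [l] between squares modulo [p], until [p] is within reach. Exhausted
    fuel counts as failure, so success alone is a certificate. *)
Fixpoint squares_dense (bound fuel : nat) (p l c : N) : bool :=
  if N.leb p (N.add c l) then true
  else if fuel is fuel'.+1 then
    if next_square bound p l c c is Some r then squares_dense bound fuel' p l r
    else false
  else false.

Definition small_prime_check (p : nat) : bool :=
  if prime p && (p != 13) then
    let n := N.of_nat p in squares_dense 200 200 n (N.succ (N.sqrt n)) 0%num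
  else true.

Lemma next_squareP fuel (p l c : N) (k : nat) r :
  next_square fuel p l c (N.add c (N.mul (N.of_nat k) p)) = Some r ->
  [/\ (N.to_nat c < N.to_nat r)%N, (N.to_nat r <= N.to_nat c + N.to_nat l)%N &
      exists y j : nat, (N.to_nat r + j * N.to_nat p = y * y)%N].
Proof.
elim: fuel k => //= fuel IH k; set t := N.add c _; set y := N.sqrt _.
case: ifP => [h [<-]|_].
  have [hy _] := N.sqrt_spec (N.add t l) (N.le_0_l _); rewrite -/y in hy.
  split; [lia | lia |].
  exists (N.to_nat y), k.
  have : N.to_nat t = (N.to_nat c + k * N.to_nat p)%N.
    by rewrite /t N2Nat.inj_add N2Nat.inj_mul Nat2N.id.
  by clearbody t; lia.
move=> h; apply: (IH k.+1); rewrite -h /t; congr next_square; lia.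
Qed.

Lemma squares_denseP bound fuel (p l c : N) (a : nat) :
  squares_dense bound fuel p l c -> (N.to_nat c < a)%N -> (a + N.to_nat l <= N.to_nat p)%N ->
  exists i y k : nat, (i < N.to_nat l)%N /\ (a + i + k * N.to_nat p = y * y)%N.
Proof.
elim: fuel c => [|fuel IH] c.
  by rewrite /=; case: ifP => //; lia.
rewrite /=; have [h|h] := boolP (N.leb p (N.add c l)); first by lia.
case e: (next_square bound p l c c) => [r|] // hr ca al.
have [|cr rl [y [k hyk]]] := @next_squareP bound p l c 0 r.
  by rewrite -e; congr next_square; lia.
have [ra|ar] := ltnP (N.to_nat r) a; first exact: (IH r).
by exists (N.to_nat r - a)%N, y, k; split; lia.
Qed.

Lemma small_primes : all (fun i => small_prime_check (4 * i + 1)) (iota 0 1024).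
Proof. by vm_compute. Qed.

Lemma no_run_small_prime (p m : nat) (a : int) : prime p -> (p %% 4 = 1)%N ->
  p != 13%N -> (m < 64)%N -> (m * m < p < (m + 1) * (m + 1))%N ->
  0 < a -> a + m < p -> ~ run m (legendre p) a.
Proof.
move=> pp p4 p13 m64 hm a0 ap ra.
(* [m < 64] gives [p < 64^2 = 4 * 1024]. *)
have p_lt : (p %/ 4 < 1024)%N by nia.
have := allP small_primes (p %/ 4)%N; rewrite mem_iota /= => /(_ p_lt).
have -> : (4 * (p %/ 4) + 1 = p)%N by lia.
rewrite /small_prime_check pp p13 => dense.
have {dense}hd : squares_dense 200 200 (N.of_nat p)
  (N.succ (N.sqrt (N.of_nat p))) 0%num := dense.
have lE : N.to_nat (N.succ (N.sqrt (N.of_nat p))) = (m + 1)%N.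
  have [] := N.sqrt_spec (N.of_nat p) (N.le_0_l _).
  by move: (N.sqrt _) => s; nia.
have [||i [y [k [hi hy]]]] := squares_denseP (a := `|a|%N) hd.
- by lia.
- by rewrite lE; lia.
rewrite lE in hi; rewrite Nat2N.id in hy.
have := ra i%:Z (ltac:(lia)).
rewrite -(legendre_periodic pp _ k) (_ : _ + _ = y%:Z * y%:Z); last by lia.
rewrite legendreM // => h.
have : 0 <= legendre p y * legendre p y by rewrite -expr2 sqr_ge0.
by rewrite h.
Qed.

(** * All primes, the greatest run, and [p = 13] *)

Lemma no_long_nonresidue_run (p m : nat) : prime p -> p != 13%N ->
  (m * m < p < (m + 1) * (m + 1))%N -> ~ has_nonresidue_run p (m + 1).
Proof.
move=> pp p13 hm [a ha].
have m0 : (0 < m)%N by have := prime_gt1 pp; case: m hm {ha} => //=; lia.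
have [p2|p2] := eqVneq p 2%N.
  have := ha 0%N; rewrite addr0 => -[|n2 []]; first by lia.
  exists 1; rewrite expr1n; move: n2; rewrite p2 => n2; apply/eqP.
  by rewrite eqz_mod_dvd; lia.
have p_gt2 : (2 < p)%N by have := prime_gt1 pp; lia.
have p_odd : odd p by case: (even_prime pp) => // e; rewrite e in p2.
have run_a : run m (legendre p) a.
  move=> i hi; apply/(quadratic_nonresidueP pp).
  have -> : i = `|i|%N%:Z by lia.
  by apply: ha; lia.
have sign x : 0 < x < p%:Z -> legendre p x = 1 \/ legendre p x = -1.
  move=> hx; apply: (legendre_neq0 pp); apply/negP => /dvdz_mod0P.
  by rewrite modz_small; lia.
have pz : 2 < p%:Z by lia.
have mz : 0 < m%:Z by lia.
have hmz : m%:Z * m%:Z < p%:Z < (m%:Z + 1) * (m%:Z + 1) by lia.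
have mul := legendreM pp; have per := legendre_periodic pp.
have m1E := legendreN1 pp p_odd.
case: eqP m1E => [p4|p4] m1E; last first.
  apply: (no_run_odd_character mz pz hmz mul per sign _ run_a) => x.
  by rewrite -mulN1r mul m1E mulN1r.
have [m64|m64] := ltnP m 64.
  have [b [b0 b1 rb]] := run_in_period mz pz hmz mul per run_a.
  exact: (no_run_small_prime pp p4 p13 m64 hm b0 b1 rb).
apply: (no_run_even_character mz pz hmz mul per sign m1E _ _ _ run_a).
- by lia.
- by exists (p %/ 4)%N%:Z; lia.
- apply/negP => /eqP h; have : (3 %| p)%N by lia.
  by rewrite dvdn_prime2 // => /eqP h3; rewrite -h3 in p4.
Qed.

Lemma has_nonresidue_run_leq p l m : (l <= m)%N ->
  has_nonresidue_run p m -> has_nonresidue_run p l.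
Proof. by move=> lm [a ha]; exists a => i il; apply: ha; apply: leq_trans lm. Qed.

Lemma nonresidue_run_bounded p m : (0 < p)%N -> has_nonresidue_run p m -> (m <= p)%N.
Proof.
move=> p0 [a ha]; rewrite leqNgt; apply/negP => mp.
have pz : p%:Z != 0 by lia.
have h0 := modz_ge0 (- a) pz; have h1 := @ltz_pmod (- a) p (ltac:(lia)).
have [|/negP[]] := ha `|(- a %% p)%Z|%N; first by lia.
apply/dvdzP; exists (- (- a %/ p)%Z).
by have := divz_eq (- a) p; lia.
Qed.

(** Descent from the bound [p], deciding each length by excluded middle. *)
Lemma greatest_nonresidue_run_exists p : (0 < p)%N ->
  exists l, greatest_nonresidue_run p l.
Proof.
move=> p0.
suff H n : (forall m, has_nonresidue_run p m -> (m <= n)%N) ->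
    exists l, greatest_nonresidue_run p l.
  by apply: (H p) => m; apply: nonresidue_run_bounded.
elim: n => [|n IH] hn.
  by exists 0%N; split => //; exists 0.
have [hr|hr] := classic (has_nonresidue_run p n.+1); first by exists n.+1.
apply: IH => m hm; have := hn m hm; rewrite leq_eqVlt ltnS => /orP[/eqP e|//].
by rewrite e in hm.
Qed.

(** The run is 5, 6, 7, 8, between the squares 4 and 9. *)
Lemma nonresidue_run_13 : has_nonresidue_run 13 4.
Proof.
exists 5 => i hi.
have sq x : ((x ^+ 2) %% 13%:Z)%Z \in [:: 0; 1; 3; 4; 9; 10; 12].
  rewrite -modzXm.
  have := @modz_ge0 x 13 isT; have := @ltz_pmod x 13 isT.
  case: (x %% 13%:Z)%Z => // n; move=> h _; have {h} : (n < 13)%N by lia.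
  by do 13!(case: n => [|n] //).
by case: i hi => [|[|[|[|]]]] // _; split => // -[x hx]; have := sq x; rewrite hx.
Qed.

Theorem mainTheorem1 (R : rcfType) (p : nat) (hp : prime p) :
  exists l : nat,
    greatest_nonresidue_run p l /\
    ((Num.sqrt p%:R < l%:R :> R) <-> p = 13%N).
Proof.
have p0 := prime_gt0 hp.
have [l hl] := greatest_nonresidue_run_exists p0.
exists l; split => //; have [hr hmax] := hl; split=> [hlt|p13]; last first.
  rewrite p13 in hmax *.
  have l4 := hmax _ nonresidue_run_13.
  apply: (@lt_le_trans _ _ 4); last by rewrite ler_nat.
  rewrite -[4]ger0_norm // -sqrtr_sqr ltr_sqrt ?exprn_gt0 //.
  by rewrite -natrX ltr_nat.
apply/eqP/negPn/negP => p13.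
have p_lt : (p < l * l)%N.
  rewrite -(ltr_nat R) natrM -expr2 -(sqr_sqrtr (ler0n R p)).
  by rewrite ltr_pXn2r // nnegrE ?sqrtr_ge0.
(* A prime is not a perfect square, so [w^2 < p] strictly, and [p < l^2] forces [l >= w + 1]. *)
have [w w0 hw] := @int_sqrt p isT.
have wN : w * w != p.
  apply/negP => /eqP wp; have p1 := prime_gt1 hp.
  have dvd_w : (`|w| %| p)%N by apply/dvdnP; exists `|w|%N; lia.
  by have /primeP[_ /(_ _ dvd_w)/orP[]/eqP] := hp; nia.
apply: (@no_long_nonresidue_run p `|w|%N hp p13); first by lia.
apply: has_nonresidue_run_leq hr; nia.
Qed.
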